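(* Consider the sparse linear Gaussian model: $S\in\{1,\dots,N\}$, $\mathcal{X}_S=\{\mathbf{x}\in\mathbb{R}^N:\|\mathbf{x}\|_0\le S\}$, $\mathbf{H}\in\mathbb{R}^{M\times N}$ with $\operatorname{spark}(\mathbf{H})>S$, $\sigma>0$, observation $\mathbf{y}=\mathbf{H}\mathbf{x}+\mathbf{n}$, $\mathbf{n}\sim\mathcal{N}(\mathbf{0},\sigma^2\mathbf{I})$, parameter function $g(\mathbf{x})=x_k$ for fixed $k\in[N]$. Let $\mathbf{x}_0\in\mathcal{X}_S$ and let $\mathcal{K}=\{k_1,\dots,k_{|\mathcal{K}|}\}\subseteq[N]$ with $|\mathcal{K}|\le S$. Let $\mathbf{P}=\mathbf{H}_{\mathcal{K}}(\mathbf{H}_{\mathcal{K}})^{\dagger}$ and let $\widetilde{\mathbf{x}}_0\in\mathbb{R}^N$ be the unique vector with $\operatorname{supp}(\widetilde{\mathbf{x}}_0)\subseteq\mathcal{K}$ satisfying $\mathbf{H}\widetilde{\mathbf{x}}_0=\mathbf{P}\mathbf{H}\mathbf{x}_0$. Let $c:\mathcal{X}_S\to\mathbb{R}$ be a bias function such that the partial derivatives $\frac{\partial c(\mathbf{x})}{\partial x_{k_i}}\big|_{\mathbf{x}=\widetilde{\mathbf{x}}_0}$ exist for all $k_i\in\mathcal{K}$, let $\gamma(\mathbf{x})=c(\mathbf{x})+x_k$, and define $\mathbf{b}_{\mathbf{x}_0}\in\mathbb{R}^{|\mathcal{K}|}$ by $(\mathbf{b}_{\mathbf{x}_0})_i=\delta_{k,k_i}+\frac{\partial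 c(\mathbf{x})}{\partial x_{k_i}}\big|_{\mathbf{x}=\widetilde{\mathbf{x}}_0}$. Then $$M(c,\mathbf{x}_0)\ \ge\ \exp\Big(-\tfrac{1}{\sigma^2}\|(\mathbf{I}-\mathbf{P})\mathbf{H}\mathbf{x}_0\|_2^2\Big)\Big[\sigma^2\mathbf{b}_{\mathbf{x}_0}^T(\mathbf{H}_{\mathcal{K}}^T\mathbf{H}_{\mathcal{K}})^{-1}\mathbf{b}_{\mathbf{x}_0}+\gamma^2(\widetilde{\mathbf{x}}_0)\Big]-\gamma^2(\mathbf{x}_0).$$
   Context: $\mathbf{H}_{\mathcal{K}}$ is the submatrix of columns of $\mathbf{H}$ indexed by $\mathcal{K}$; $\dagger$ = pseudoinverse; $\delta$ is the Kronecker delta; $\operatorname{supp}$ = set of indices of nonzero entries. An estimator $\hat g:\mathbb{R}^M\to\mathbb{R}$ has bias $b(\hat g;\mathbf{x})=\mathsf{E}_{\mathbf{x}}\{\hat g(\mathbf{y})\}-x_k$ and variance $v(\hat g;\mathbf{x})$; $M(c,\mathbf{x}_0)$ is the infimum of $v(\hat g;\mathbf{x}_0)$ over all estimators with $v(\hat g;\mathbf{x}_0)<\infty$ and $b(\hat g;\mathbf{x})=c(\mathbf{x})$ for all $\mathbf{x}\in\mathcal{X}_S$ (and $+\infty$ if there is none). *)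

(* Defs.v *)
From HB Require Import structures.
From mathcomp Require Import all_boot all_order all_algebra.
From mathcomp Require Import all_classical all_reals all_analysis.
From mathcomp Require Import normal_distribution.

Set Implicit Arguments.
Unset Strict Implicit.
Unset Printing Implicit Defensive.

Import Order.TTheory GRing.Theory Num.Theory.
Import numFieldNormedType.Exports.

Local Open Scope classical_set_scope.
Local Open Scope ring_scope.

Definition l0norm {R : pzRingType} {N : nat} (x : 'cV[R]_N) : nat :=
  #|[set i : 'I_N | x i 0 != 0]|.

Definition supp {R : pzRingType} {N : nat} (x : 'cV[R]_N) : {set 'I_N} :=
  [set i : 'I_N | x i 0 != 0].

Definition sparse_set {R : pzRingType} (N S : nat) : set 'cV[R]_N :=
  [set x | (l0norm x <= S)%N].

(* H_K : the columns of H indexed by K, in increasing order k_1 < ... *)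
Definition colsK {R : Type} {M N : nat} (H : 'M[R]_(M, N)) (K : {set 'I_N})
  : 'M[R]_(M, #|K|) :=
  colsub (fun j : 'I_#|K| => enum_val j) H.

Definition cols_indep {F : fieldType} {M N : nat} (H : 'M[F]_(M, N))
  (T : {set 'I_N}) : bool :=
  \rank (colsK H T) == #|T|.

(* spark H = smallest number of linearly dependent columns of H;
   if all columns are independent, spark H = +infinity, encoded as N.+1 *)
Definition spark {F : fieldType} {M N : nat} (H : 'M[F]_(M, N)) : nat :=
  \big[minn/N.+1]_(T : {set 'I_N} | ~~ cols_indep H T) #|T|.

Definition is_pinv {R : pzRingType} {m n : nat} (A : 'M[R]_(m, n))
  (B : 'M[R]_(n, m)) : Prop :=
  [/\ A *m B *m A = A, B *m A *m B = B,
      (A *m B)^T = A *m B & (B *m A)^T = B *m A].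

(* The Moore-Penrose pseudoinverse A^dagger (exists and is unique) *)
Definition mp_pinv {R : realType} {m n : nat} (A : 'M[R]_(m, n)) : 'M[R]_(n, m) :=
  xget 0 [set B | is_pinv A B].

Definition sqnorm {R : pzRingType} {n : nat} (v : 'cV[R]_n) : R :=
  \sum_i v i 0 ^+ 2.

(* Observations y live in R^M, represented as M.-tuple R with the      *)
(* product (Borel) sigma-algebra.                                       *)

Local Open Scope ereal_scope.

(* Integral of a nonnegative function f : R^n -> [0,+oo] against the
   product Gaussian measure  N(m 0, s^2) x ... x N(m (n-1), s^2),
   computed as an iterated integral (Tonelli). *)
Fixpoint gauss_int {R : realType} (s : R) (n : nat) :
  (nat -> R) -> (n.-tuple R -> \bar R) -> \bar R :=
  match n return (nat -> R) -> (n.-tuple R -> \bar R) -> \bar R with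
  | 0 => fun _ f => f [tuple]
  | n'.+1 => fun m f =>
      \int[normal_prob (m 0%N) s]_(y in [set: R])
        gauss_int s (fun i => m i.+1) (fun t => f (cons_tuple y t))
  end.

Definition model_mean {R : realType} {M N : nat} (H : 'M[R]_(M, N))
  (x : 'cV[R]_N) : nat -> R :=
  fun i => match @insub nat (fun i => i < M)%N 'I_M i with
           | Some j => (H *m x) j ord0
           | None => 0%R
           end.

Definition mean_est {R : realType} {M N : nat} (H : 'M[R]_(M, N)) (sigma : R)
  (x : 'cV[R]_N) (g : M.-tuple R -> R) : \bar R :=
  gauss_int sigma (model_mean H x) (fun y => (Num.max (g y) 0%R)%:E)
  - gauss_int sigma (model_mean H x) (fun y => (Num.max (- g y) 0%R)%:E).

Definition var_est {R : realType} {M N : nat} (H : 'M[R]_(M, N)) (sigma : R)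
  (x : 'cV[R]_N) (g : M.-tuple R -> R) : \bar R :=
  gauss_int sigma (model_mean H x)
    (fun y => ((g y - fine (mean_est H sigma x g)) ^+ 2)%:E).

(* M(c, x0): infimum of v(g; x0) over all (measurable) estimators g with
   v(g; x0) < oo and bias b(g; x) = E_x{g(y)} - x_k = c(x) on X_S;
   +oo if there is no such estimator (ereal_inf set0 = +oo). *)
Definition min_var {R : realType} {M N : nat} (S : nat) (H : 'M[R]_(M, N))
  (sigma : R) (k : 'I_N) (c : 'cV[R]_N -> R) (x0 : 'cV[R]_N) : \bar R :=
  ereal_inf [set var_est H sigma x0 g | g in
    [set g : M.-tuple R -> R |
       [/\ measurable_fun [set: M.-tuple R] g,
           var_est H sigma x0 g < +oo &
           forall x, sparse_set S x ->
             mean_est H sigma x g = (c x + x k ord0)%:E]]].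

(* Main.v *)
Require Import Defs.
From HB Require Import structures.
From mathcomp Require Import all_boot all_order all_algebra.
From mathcomp Require Import all_classical all_reals all_analysis.
From mathcomp Require Import measurable_realfun.
From mathcomp Require Import ring lra.
Import Order.TTheory GRing.Theory Num.Theory.
Import numFieldNormedType.Exports.
Local Open Scope classical_set_scope.
Local Open Scope ring_scope.

Set Implicit Arguments.
Unset Strict Implicit.
Unset Printing Implicit Defensive.

(** Let p_x be the density of N(Hx, sigma^2 I) relative to N(Hx0, sigma^2 I).
    An admissible estimator g satisfies E_x0[g p_x] = gamma(x) for all S-sparse
    x, and E_x0[p_x p_x'] = exp(<H(x - x0), H(x' - x0)> / sigma^2), because
    p_x p_x' is a constant multiple of p_(x + x' - x0). Hence the covariance of
    g with any linear combination of the p_x is prescribed, and bounds the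
    variance of g from below. Take alpha p_xt plus a combination of the
    difference quotients of p_x at xt in the directions of K. Since H(xt - x0)
    is orthogonal to the range of H_K, the kernel factors as
    exp(|(I - P) H x0|^2 / sigma^2) times a kernel centred at xt. Letting the
    step tend to 0 and choosing the optimal coefficients, proportional to
    gamma(xt) and sigma^2 (H_K^T H_K)^-1 b, gives the bound. *)

Section integral_density.
Context (d : measure_display) (T : measurableType d) (R : realType).
Variables (mu : {sigma_finite_measure set T -> \bar R}).
Variables (nu : {finite_measure set T -> \bar R}) (p : T -> \bar R).
Hypothesis measurable_p : measurable_fun setT p.
Hypothesis nuE : forall A, measurable A -> nu A = (\int[mu]_(x in A) p x)%E.

Lemma density_dominates : nu `<< mu.
Proof.
apply/null_content_dominatesP => A mA muA0; rewrite nuE//.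
by apply: null_set_integral => //; exact: measurable_funTS.
Qed.

Lemma ge0_integral_density (f : T -> \bar R) :
  measurable_fun setT f -> (forall x, 0 <= f x)%E ->
  (\int[nu]_x f x = \int[mu]_x (f x * p x))%E.
Proof.
move=> mf f0; have numu := density_dominates.
rewrite -(Radon_Nikodym_SigmaFinite.change_of_variables numu)//.
have ip := Radon_Nikodym_SigmaFinite.f_integrable numu.
have mdnu := measurable_int _ ip.
apply: ae_eq_integral => //; [exact: emeasurable_funM|exact: emeasurable_funM|].
apply: ae_eqe_mul2l; apply: integral_ae_eq => // A _ mA.
by rewrite -Radon_Nikodym_SigmaFinite.f_integral// nuE.
Qed.

End integral_density.

Lemma integrable_sqr_Lfun2 (d : measure_display) (T : measurableType d)
    (R : realType) (mu : {measure set T -> \bar R}) (f : T -> R) :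
  measurable_fun setT f -> mu.-integrable setT (EFin \o (fun x => f x ^+ 2)) ->
  f \in Lfun mu 2%:E.
Proof.
move=> mf /integrableP[_ f2]; rewrite inE; apply/andP; split; rewrite inE//=.
rewrite /finite_norm unlock /Lnorm poweR_lty//; move: f2.
by under eq_integral do rewrite /= normrX -powR_mulrn//.
Qed.

(** * Gaussian likelihood ratios *)

Definition normal_lr {R : realType} (s m0 m y : R) : R :=
  expR ((y - m0) * (m - m0) / s ^+ 2 - (m - m0) ^+ 2 / (s ^+ 2 *+ 2)).

Lemma measurable_normal_lr (R : realType) (s m0 m : R) :
  measurable_fun [set: R] (normal_lr s m0 m).
Proof.
apply: measurableT_comp => //; apply: measurable_funB => //.
by do 2!apply: measurable_funM => //; exact: measurable_funB.
Qed.

Lemma normal_pdf_lr (R : realType) (s m0 m y : R) : s != 0 ->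
  normal_pdf m s y = normal_lr s m0 m y * normal_pdf m0 s y.
Proof.
move=> s0; rewrite !normal_pdfE// /normal_fun mulrCA; congr (_ * _).
by rewrite -expRD; congr expR; field.
Qed.

Lemma ge0_integral_normal_prob (R : realType) (s m : R) (f : R -> \bar R) :
  measurable_fun [set: R] f -> (forall y, 0 <= f y)%E ->
  (\int[normal_prob m s]_y f y =
   \int[lebesgue_measure]_y (f y * (normal_pdf m s y)%:E))%E.
Proof.
apply: (@ge0_integral_density _ (measurableTypeR R)) => //.
by apply/measurable_EFinP; exact: measurable_normal_pdf.
Qed.

Lemma ge0_integral_normal_prob_lr (R : realType) (s m0 m : R)
    (f : R -> \bar R) :
  s != 0 -> measurable_fun [set: R] f -> (forall y, 0 <= f y)%E ->
  (\int[normal_prob m s]_y f y =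
   \int[normal_prob m0 s]_y (f y * (normal_lr s m0 m y)%:E))%E.
Proof.
move=> s0 mf f0.
have mflr : measurable_fun [set: R]
    (fun y => (f y * (normal_lr s m0 m y)%:E)%E).
  apply: emeasurable_funM => //; apply/measurable_EFinP.
  exact: measurable_normal_lr.
have flr0 y : (0 <= f y * (normal_lr s m0 m y)%:E)%E.
  by rewrite mule_ge0// lee_fin expR_ge0.
rewrite [LHS](ge0_integral_normal_prob s m mf f0).
rewrite [RHS](ge0_integral_normal_prob s m0 mflr flr0).
apply: eq_integral => y _.
by rewrite (normal_pdf_lr m0 m y s0) EFinM muleA.
Qed.

Section gauss_prob.
Context (R : realType).

(* [normal_prob] lives on [measurableTypeR R], whose display differs from the
   default one carried by [R]. *)
Definition cons_pair (n : nat) (z : measurableTypeR R * n.-tuple R) :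
  n.+1.-tuple R := cons_tuple z.1 z.2.

Lemma measurable_cons_pair (n : nat) : measurable_fun setT (@cons_pair n).
Proof.
by apply: (@measurable_cons _ _ (measurableTypeR R * n.-tuple R)%type R fst n
  snd).
Qed.

HB.instance Definition _ (n : nat) := isMeasurableFun.Build _ _ _ _
  (@cons_pair n) (@measurable_cons_pair n).

Fixpoint gauss_prob (s : R) (n : nat) (m : nat -> R) :
    probability (n.-tuple R) R :=
  match n with
  | 0 => @dirac _ (0.-tuple R) [tuple] R
  | n'.+1 => distribution
      (normal_prob (m 0%N) s \x gauss_prob s n' (fun i => m i.+1))%E
      (@cons_pair n')
  end.

Lemma ge0_integral_gauss_probS (s : R) (n : nat) (m : nat -> R)
    (f : n.+1.-tuple R -> \bar R) :
  measurable_fun setT f -> (forall t, 0 <= f t)%E ->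
  (\int[gauss_prob s n.+1 m]_t f t = \int[normal_prob (m 0%N) s]_y
    \int[gauss_prob s n (fun i => m i.+1)]_t f (cons_tuple y t))%E.
Proof.
move=> mf f0; rewrite ge0_integral_distribution//= fubini_tonelli1//.
by apply: measurableT_comp => //; exact: measurable_cons_pair.
Qed.

Lemma measurable_comp_cons_tuple (n : nat) (y : R)
    (f : n.+1.-tuple R -> \bar R) :
  measurable_fun setT f ->
  measurable_fun [set: n.-tuple R] (fun t => f (cons_tuple y t)).
Proof.
move=> mf; apply: measurableT_comp => //.
exact: (@measurable_cons _ _ (n.-tuple R) R (cst y) n id).
Qed.

Lemma gauss_intE (s : R) (n : nat) (m : nat -> R) (f : n.-tuple R -> \bar R) :
  measurable_fun setT f -> (forall t, 0 <= f t)%E ->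
  gauss_int s m f = (\int[gauss_prob s n m]_t f t)%E.
Proof.
elim: n m f => [|n IH] m f mf f0.
  by rewrite /= integral_dirac// diracT mul1e.
rewrite ge0_integral_gauss_probS//=; apply: eq_integral => y _.
by rewrite IH//; exact: measurable_comp_cons_tuple.
Qed.

Lemma measurable_integral_cons (s : R) (n : nat) (m : nat -> R)
    (f : n.+1.-tuple R -> \bar R) :
  measurable_fun setT f -> (forall t, 0 <= f t)%E ->
  measurable_fun [set: measurableTypeR R]
    (fun y => \int[gauss_prob s n m]_t f (cons_tuple y t))%E.
Proof.
move=> mf f0; apply: (@measurable_fun_fubini_tonelli_F _ _ (measurableTypeR R)
  (n.-tuple R) R (gauss_prob s n m) (f \o @cons_pair n)).
  by apply: measurableT_comp => //; exact: measurable_cons_pair.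
by move=> z; exact: f0.
Qed.

Definition gauss_lr (s : R) (n : nat) (m0 m : nat -> R) (t : n.-tuple R) : R :=
  \prod_(i < n) normal_lr s (m0 i) (m i) (tnth t i).

Lemma gauss_lr_ge0 (s : R) (n : nat) (m0 m : nat -> R) (t : n.-tuple R) :
  0 <= gauss_lr s m0 m t.
Proof. by apply: prodr_ge0 => i _; exact: expR_ge0. Qed.

Lemma measurable_gauss_lr (s : R) (n : nat) (m0 m : nat -> R) :
  measurable_fun [set: n.-tuple R] (gauss_lr s m0 m).
Proof.
apply: measurable_prod => i _.
apply: (measurableT_comp (measurable_normal_lr s (m0 i) (m i))).
exact: measurable_tnth.
Qed.

Lemma gauss_lr_cons (s : R) (n : nat) (m0 m : nat -> R) (y : R)
    (t : n.-tuple R) :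
  gauss_lr s m0 m (cons_tuple y t) = normal_lr s (m0 0%N) (m 0%N) y *
    gauss_lr s (fun i => m0 i.+1) (fun i => m i.+1) t.
Proof.
rewrite /gauss_lr big_ord_recl; congr (_ * _).
by apply: eq_bigr => i _; rewrite tnthS.
Qed.

Lemma gauss_lrM (s : R) (n : nat) (m0 m m' : nat -> R) (t : n.-tuple R) :
  s != 0 ->
  gauss_lr s m0 m t * gauss_lr s m0 m' t =
  expR ((\sum_(i < n) (m i - m0 i) * (m' i - m0 i)) / s ^+ 2) *
  gauss_lr s m0 (fun i => m i + m' i - m0 i) t.
Proof.
move=> s0; rewrite mulr_suml expR_sum -!big_split /=; apply: eq_bigr => i _.
by rewrite /normal_lr -!expRD; congr expR; field.
Qed.

Lemma ge0_integral_gauss_prob_lr (s : R) (n : nat) (m0 m : nat -> R)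
    (f : n.-tuple R -> \bar R) :
  s != 0 -> measurable_fun setT f -> (forall t, 0 <= f t)%E ->
  (\int[gauss_prob s n m]_t f t =
   \int[gauss_prob s n m0]_t (f t * (gauss_lr s m0 m t)%:E))%E.
Proof.
move=> s0; elim: n m0 m f => [|n IH] m0 m f mf f0.
  by apply: eq_integral => t _; rewrite /gauss_lr big_ord0 mule1.
have mflr : measurable_fun setT (fun t => (f t * (gauss_lr s m0 m t)%:E)%E).
  apply: emeasurable_funM => //; apply/measurable_EFinP.
  exact: measurable_gauss_lr.
have flr0 t : (0 <= f t * (gauss_lr s m0 m t)%:E)%E.
  by rewrite mule_ge0// lee_fin gauss_lr_ge0.
rewrite [LHS](ge0_integral_gauss_probS s m mf f0).
rewrite [RHS](ge0_integral_gauss_probS s m0 mflr flr0).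
rewrite [LHS](ge0_integral_normal_prob_lr (m0 0%N))//; last 2 first.
- exact: measurable_integral_cons.
- by move=> y; exact: integral_ge0.
apply: eq_integral => y _.
set m0' := fun i => m0 i.+1; set m' := fun i => m i.+1.
rewrite (IH m0')//; last exact: measurable_comp_cons_tuple.
rewrite muleC -ge0_integralZl//; last 3 first.
- apply: emeasurable_funM; first exact: measurable_comp_cons_tuple.
  by apply/measurable_EFinP; exact: measurable_gauss_lr.
- by move=> t _; rewrite mule_ge0// lee_fin gauss_lr_ge0.
- by rewrite lee_fin expR_ge0.
by apply: eq_integral => t _; rewrite gauss_lr_cons EFinM muleCA.
Qed.

Section likelihood_ratio_moments.
Variables (s : R) (n : nat) (m0 : nat -> R).
Hypothesis s_neq0 : s != 0.
Local Notation P0 := (gauss_prob s n m0).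
Local Notation lr := (gauss_lr s m0).

Lemma expectation_gauss_prob_lr (m : nat -> R) (g : n.-tuple R -> R) :
  measurable_fun setT g ->
  ('E_(gauss_prob s n m)[g] = 'E_P0[g * lr m])%E.
Proof.
move=> mg; have mEg : measurable_fun setT (EFin \o g) by exact/measurable_EFinP.
rewrite unlock [LHS]integralE [RHS]integralE.
rewrite (ge0_integral_gauss_prob_lr m0 m _ (measurable_funepos mEg))//.
rewrite (ge0_integral_gauss_prob_lr m0 m _ (measurable_funeneg mEg))//.
congr (_ - _)%E; apply: eq_integral => t _.
  by rewrite !funeposE maxe_pMl ?lee_fin ?gauss_lr_ge0// mul0e.
by rewrite !funenegE maxe_pMl ?lee_fin ?gauss_lr_ge0// mul0e mulNe.
Qed.

Lemma expectation_gauss_lr (m : nat -> R) : ('E_P0[lr m] = 1)%E.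
Proof.
transitivity ('E_(gauss_prob s n m)[cst 1%R])%E; last exact: expectation_cst.
rewrite [RHS]expectation_gauss_prob_lr//; congr expectation.
by apply/funext => t; rewrite /= mul1r.
Qed.

Lemma Lfun1_gauss_lr (m : nat -> R) : (lr m : n.-tuple R -> R) \in Lfun P0 1.
Proof.
apply/Lfun1_integrable/integrableP; split.
  by apply/measurable_EFinP; exact: measurable_gauss_lr.
under eq_integral do rewrite /= ger0_norm ?gauss_lr_ge0//.
by have := expectation_gauss_lr m; rewrite unlock => ->; rewrite ltry.
Qed.

Lemma Lfun2_gauss_lr (m : nat -> R) : (lr m : n.-tuple R -> R) \in Lfun P0 2%:E.
Proof.
apply: integrable_sqr_Lfun2; first exact: measurable_gauss_lr.
apply/Lfun1_integrable; under eq_fun do rewrite expr2 gauss_lrM// mulrC.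
exact: Lfun_scale (Lfun1_gauss_lr _).
Qed.

Lemma expectation_gauss_lrM (m m' : nat -> R) :
  ('E_P0[lr m * lr m'] =
   (expR ((\sum_(i < n) (m i - m0 i) * (m' i - m0 i)) / s ^+ 2))%:E)%E.
Proof.
set e := expR _.
rewrite (_ : (lr m * lr m')%R = (e \o* lr (fun i => m i + m' i - m0 i))%R).
  by rewrite expectationZl ?Lfun1_gauss_lr// expectation_gauss_lr mule1.
by apply/funext => t; rewrite [LHS]gauss_lrM// mulrC.
Qed.

End likelihood_ratio_moments.

End gauss_prob.

(** * Variance bounds in L^2 *)

Section variance_bounds.
Context (d : measure_display) (T : measurableType d) (R : realType).
Variable P : probability T R.
Implicit Types X Y : T -> R.

Lemma probability_Lfun2_Lfun1 X : X \in Lfun P 2%:E -> X \in Lfun P 1.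
Proof. by apply: Lfun_subset12; exact: fin_num_measure. Qed.

Lemma variance_lty_Lfun2 X :
  measurable_fun setT X -> ('V_P[X] < +oo)%E -> X \in Lfun P 2%:E.
Proof.
move=> mX VX; set mean := fine 'E_P[X].
have mXc : measurable_fun setT (X \- cst mean) by exact: measurable_funB.
rewrite -[X](subrK (cst mean)) rpredD ?lee1n// => p1; last exact: Lfun_cst.
apply: integrable_sqr_Lfun2 => //; apply/integrableP; split.
  by apply/measurable_EFinP; exact: measurable_funX.
under eq_integral do rewrite /= ger0_norm ?sqr_ge0//.
by move: VX; rewrite /variance covariance.unlock -/mean unlock.
Qed.

Lemma variance_ge_covariance X Y :
  X \in Lfun P 2%:E -> Y \in Lfun P 2%:E ->
  (2%:E * covariance P X Y - 'V_P[Y] <= 'V_P[X])%E.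
Proof.
move=> X2 Y2; have := variance_ge0 P (X \- Y); rewrite varianceB//.
have X1 := probability_Lfun2_Lfun1 X2; have Y1 := probability_Lfun2_Lfun1 Y2.
have XY1 := Lfun2_mul_Lfun1 X2 Y2.
rewrite -(fineK (variance_fin_num X2)) -(fineK (variance_fin_num Y2)).
rewrite -(fineK (covariance_fin_num X1 Y1 XY1)).
by rewrite -!EFinM -EFinD -!EFinB !lee_fin; lra.
Qed.

Section linear_combinations.
Variables (I : Type) (L : I -> T -> R) (a : I -> R).
Hypothesis Lfun2_L : forall i, L i \in Lfun P 2%:E.

Lemma Lfun2_lincomb (r : seq I) : \sum_(i <- r) a i *: L i \in Lfun P 2%:E.
Proof. by rewrite rpred_sum ?lee1n// => p1 i _; exact: rpredZ. Qed.

Lemma covariance_lincombl (r : seq I) Y : Y \in Lfun P 2%:E ->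
  covariance P (\sum_(i <- r) a i *: L i) Y =
  (\sum_(i <- r) (a i)%:E * covariance P (L i) Y)%E.
Proof.
move=> Y2; elim: r => [|i r IH].
  by rewrite !big_nil; exact: covariance_cst_l.
rewrite !big_cons -IH covarianceDl ?Lfun2_lincomb ?rpredZ ?lee1n//.
congr (_ + _)%E; rewrite (_ : a i *: L i = a i \o* L i).
  by apply: covarianceZl; [exact: probability_Lfun2_Lfun1..|
    exact: Lfun2_mul_Lfun1].
by apply/funext => x; exact: mulrC.
Qed.

End linear_combinations.

Lemma variance_ge_lincomb (I : finType) X (L : I -> T -> R) (a c : I -> R)
    (G : I -> I -> R) :
  X \in Lfun P 2%:E -> (forall i, L i \in Lfun P 2%:E) ->
  (forall i, covariance P X (L i) = (c i)%:E) ->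
  (forall i j, covariance P (L i) (L j) = (G i j)%:E) ->
  ((2 * (\sum_i a i * c i) - \sum_i \sum_j a i * a j * G i j)%:E <=
   'V_P[X])%E.
Proof.
move=> X2 L2 cE GE; set l := \sum_i a i *: L i.
have l2 : l \in Lfun P 2%:E by exact: Lfun2_lincomb.
have covl Y y : Y \in Lfun P 2%:E ->
    (forall i, covariance P (L i) Y = (y i)%:E) ->
    covariance P l Y = (\sum_i a i * y i)%:E.
  move=> Y2 yE; rewrite covariance_lincombl// -sumEFin.
  by apply: eq_bigr => i _; rewrite yE EFinM.
have cov_Xl : covariance P X l = (\sum_i a i * c i)%:E.
  by rewrite covarianceC; apply: covl => // i; rewrite covarianceC.
have var_l : 'V_P[l]%E = (\sum_i \sum_j a i * a j * G i j)%:E.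
  rewrite /variance (covl l (fun i => \sum_j a j * G i j))// => [|i].
    congr _%:E; apply: eq_bigr => i _; rewrite mulr_sumr.
    by apply: eq_bigr => j _; rewrite mulrA.
  by rewrite covarianceC; apply: covl => // j; rewrite covarianceC GE.
by rewrite EFinB EFinM -cov_Xl -var_l; exact: variance_ge_covariance.
Qed.

End variance_bounds.

(** * Gram matrices and pseudoinverses *)

Definition dot {R : pzRingType} {n : nat} (u v : 'cV[R]_n) : R :=
  (u^T *m v) 0 0.

Section dot_theory.
Context (R : comPzRingType).

Lemma dotC (n : nat) (u v : 'cV[R]_n) : dot u v = dot v u.
Proof. by rewrite /dot !mxE; apply: eq_bigr => i _; rewrite !mxE mulrC. Qed.

Lemma dotDl (n : nat) (u v w : 'cV[R]_n) : dot (u + v) w = dot u w + dot v w.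
Proof. by rewrite /dot linearD mulmxDl mxE. Qed.

Lemma dotDr (n : nat) (u v w : 'cV[R]_n) : dot u (v + w) = dot u v + dot u w.
Proof. by rewrite /dot mulmxDr mxE. Qed.

Lemma dotZl (n : nat) (a : R) (u v : 'cV[R]_n) : dot (a *: u) v = a * dot u v.
Proof. by rewrite /dot linearZ -scalemxAl mxE. Qed.

Lemma dotZr (n : nat) (a : R) (u v : 'cV[R]_n) : dot u (a *: v) = a * dot u v.
Proof. by rewrite /dot -scalemxAr mxE. Qed.

Lemma dot0r (n : nat) (u : 'cV[R]_n) : dot u 0 = 0.
Proof. by rewrite /dot mulmx0 mxE. Qed.

Lemma dot_mulmxl (m n : nat) (A : 'M[R]_(m, n)) (u : 'cV[R]_n)
    (v : 'cV[R]_m) :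
  dot (A *m u) v = dot u (A^T *m v).
Proof. by rewrite /dot trmx_mul mulmxA. Qed.

Lemma dot_delta (n : nat) (A : 'M[R]_n) (i j : 'I_n) :
  dot (delta_mx i 0) (A *m delta_mx j 0) = A i j.
Proof. by rewrite /dot -colE trmx_delta -rowE !mxE. Qed.

Lemma dotE (n : nat) (u v : 'cV[R]_n) : dot u v = \sum_i u i 0 * v i 0.
Proof. by rewrite /dot mxE; apply: eq_bigr => i _; rewrite mxE. Qed.

Lemma dot_mulmxE (n : nat) (A : 'M[R]_n) (u : 'cV[R]_n) :
  dot u (A *m u) = \sum_i \sum_j u i 0 * u j 0 * A i j.
Proof.
rewrite dotE; apply: eq_bigr => i _; rewrite mxE mulr_sumr.
by apply: eq_bigr => j _; rewrite mulrAC mulrA.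
Qed.

End dot_theory.

Lemma sqnormE (R : pzRingType) (n : nat) (v : 'cV[R]_n) : sqnorm v = dot v v.
Proof. by rewrite /dot mxE; apply: eq_bigr => i _; rewrite mxE expr2. Qed.

Lemma sqnorm_eq0 (R : realDomainType) (n : nat) (v : 'cV[R]_n) :
  sqnorm v = 0 -> v = 0.
Proof.
move=> /eqP; rewrite psumr_eq0; last by move=> i _; exact: sqr_ge0.
move=> /allP v0; apply/colP => i; rewrite mxE.
by have := v0 i (mem_index_enum i); rewrite /= sqrf_eq0 => /eqP.
Qed.

Lemma sqnormN (R : pzRingType) (n : nat) (v : 'cV[R]_n) :
  sqnorm (- v) = sqnorm v.
Proof. by apply: eq_bigr => i _; rewrite mxE sqrrN. Qed.

Lemma gram_unitmx (R : realFieldType) (m n : nat) (A : 'M[R]_(m, n)) :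
  \rank A = n -> A^T *m A \in unitmx.
Proof.
move=> rA; rewrite -row_free_unit -kermx_eq0; apply/eqP/row_matrixP => i.
rewrite row0; set v := row i _.
have vG : v *m (A^T *m A) = 0 by apply/sub_kermxP; exact: row_sub.
have /(congr1 trmx) : A *m v^T = 0.
  apply: sqnorm_eq0; rewrite sqnormE /dot trmx_mul trmxK mulmxA -(mulmxA v) vG.
  by rewrite mul0mx mxE.
rewrite trmx_mul trmxK trmx0 -[in RHS](mul0mx _ A^T).
by apply: row_free_inj; rewrite /row_free mxrank_tr rA.
Qed.

Lemma mp_pinvP (R : realType) (m n : nat) (A : 'M[R]_(m, n)) :
  \rank A = n -> is_pinv A (mp_pinv A).
Proof.
move=> /gram_unitmx uA.
suff pA : is_pinv A (invmx (A^T *m A) *m A^T) by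
  exact: (@xgetI _ 0 [set B | is_pinv A B] _ pA).
split.
- by rewrite -!mulmxA mulVmx// mulmx1.
- by rewrite -[_ *m A^T *m A]mulmxA mulVmx// mul1mx.
- by rewrite !trmx_mul trmxK trmx_inv trmx_mul trmxK mulmxA.
- by rewrite -mulmxA mulVmx// trmx1.
Qed.

Lemma trmx_mul_pinv_residual (R : comPzRingType) (m n : nat) (A : 'M[R]_(m, n))
    (B : 'M[R]_(n, m)) :
  is_pinv A B -> A^T *m (1%:M - A *m B) = 0.
Proof.
move=> [ABA _ ABT _]; rewrite mulmxBr mulmx1 -ABT -trmx_mul ABA.
exact: subrr.
Qed.

(** * The Barankin bound *)

Section estimators.
Context (R : realType) (M N : nat) (H : 'M[R]_(M, N)) (sigma : R).
Variable g : M.-tuple R -> R.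
Hypothesis measurable_g : measurable_fun setT g.
Local Notation Prob x := (gauss_prob sigma M (model_mean H x)).

Lemma mean_estE (x : 'cV[R]_N) : mean_est H sigma x g = ('E_(Prob x)[g])%E.
Proof.
have mEg : measurable_fun setT (EFin \o g) by exact/measurable_EFinP.
have posE : (fun y => (Num.max (g y) 0)%:E) = (EFin \o g)^\+%E.
  by apply/funext => y; rewrite funeposE EFin_max.
have negE : (fun y => (Num.max (- g y) 0)%:E) = (EFin \o g)^\-%E.
  by apply/funext => y; rewrite funenegE EFin_max.
rewrite unlock integralE /mean_est posE negE.
rewrite (gauss_intE _ _ (measurable_funepos mEg))//.
by rewrite (gauss_intE _ _ (measurable_funeneg mEg)).
Qed.

Lemma var_estE (x : 'cV[R]_N) : var_est H sigma x g = ('V_(Prob x)[g])%E.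
Proof.
rewrite /var_est /variance covariance.unlock mean_estE; set mean := fine _.
rewrite unlock gauss_intE//.
- apply/measurable_EFinP/measurable_funX; exact: measurable_funB.
- by move=> t; rewrite lee_fin sqr_ge0.
Qed.

End estimators.

Lemma model_meanE (R : realType) (M N : nat) (H : 'M[R]_(M, N))
    (x : 'cV[R]_N) (i : 'I_M) :
  model_mean H x i = (H *m x) i 0.
Proof. by rewrite /model_mean valK. Qed.

Definition prescribed_mean {R : pzRingType} {N : nat} (k : 'I_N)
  (c : 'cV[R]_N -> R) (x : 'cV[R]_N) : R := c x + x k 0.

Lemma le_centred_quadratic (R : realDomainType) (I : finType) (a c : I -> R)
    (G : I -> I -> R) (c0 : R) :
  2 * (\sum_i a i * c i) - \sum_i \sum_j a i * a j * G i j - c0 ^+ 2 <=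
  2 * (\sum_i a i * (c i - c0)) - \sum_i \sum_j a i * a j * (G i j - 1).
Proof.
have -> : \sum_i a i * (c i - c0) = \sum_i a i * c i - (\sum_i a i) * c0.
  by rewrite mulr_suml -sumrB; apply: eq_bigr => i _; rewrite mulrBr.
have -> : \sum_i \sum_j a i * a j * (G i j - 1) =
    \sum_i \sum_j a i * a j * G i j - (\sum_i a i) ^+ 2.
  rewrite [_ ^+ 2]expr2 mulr_suml -sumrB; apply: eq_bigr => i _.
  by rewrite mulr_sumr -sumrB; apply: eq_bigr => j _; rewrite mulrBr mulr1.
by have := sqr_ge0 (\sum_i a i - c0); nra.
Qed.

Section barankin.
Context (R : realType) (M N S : nat) (H : 'M[R]_(M, N)) (sigma : R) (k : 'I_N).
Context (c : 'cV[R]_N -> R) (x0 : 'cV[R]_N).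
Hypothesis sigma_neq0 : sigma != 0.
Hypothesis sparse_x0 : sparse_set S x0.
Local Notation gamma := (prescribed_mean k c).
Local Notation P0 := (gauss_prob sigma M (model_mean H x0)).

Definition model_lr (x : 'cV[R]_N) : M.-tuple R -> R :=
  gauss_lr sigma (model_mean H x0) (model_mean H x).

Definition lr_kernel (x x' : 'cV[R]_N) : R :=
  expR (dot (H *m (x - x0)) (H *m (x' - x0)) / sigma ^+ 2).

Lemma expectation_model_lrM (x x' : 'cV[R]_N) :
  ('E_P0[model_lr x * model_lr x'] = (lr_kernel x x')%:E)%E.
Proof.
rewrite /lr_kernel (_ : dot _ _ = \sum_(i < M)
  (model_mean H x i - model_mean H x0 i) *
  (model_mean H x' i - model_mean H x0 i)); first exact: expectation_gauss_lrM.
rewrite /dot mxE; apply: eq_bigr => i _.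
by rewrite !model_meanE !mulmxBr !mxE.
Qed.

Lemma covariance_model_lr (x x' : 'cV[R]_N) :
  covariance P0 (model_lr x) (model_lr x') = (lr_kernel x x' - 1)%:E.
Proof.
rewrite covarianceE ?Lfun1_gauss_lr ?Lfun2_mul_Lfun1 ?Lfun2_gauss_lr//.
by rewrite expectation_model_lrM !expectation_gauss_lr// mule1.
Qed.

Lemma covariance_estimator_model_lr (g : M.-tuple R -> R) (x : 'cV[R]_N)
    (r r0 : R) :
  measurable_fun setT g -> g \in Lfun P0 2%:E ->
  mean_est H sigma x g = r%:E -> mean_est H sigma x0 g = r0%:E ->
  covariance P0 g (model_lr x) = (r - r0)%:E.
Proof.
move=> mg g2; rewrite !mean_estE//.
rewrite (expectation_gauss_prob_lr (model_mean H x0))// => gx gx0.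
have g1 := probability_Lfun2_Lfun1 g2.
rewrite covarianceE ?Lfun1_gauss_lr ?Lfun2_mul_Lfun1 ?Lfun2_gauss_lr//.
by rewrite expectation_gauss_lr// mule1 gx0 EFinB -gx.
Qed.

Lemma barankin_bound (I : finType) (X : I -> 'cV[R]_N) (a : I -> R) :
  (forall i, sparse_set S (X i)) ->
  ((2 * (\sum_i a i * gamma (X i)) -
    \sum_i \sum_j a i * a j * lr_kernel (X i) (X j) - gamma x0 ^+ 2)%:E <=
   min_var S H sigma k c x0)%E.
Proof.
move=> sX; apply: le_ereal_inf_tmp => _ [g [mg vg cg] <-].
rewrite var_estE// in vg *; have g2 := variance_lty_Lfun2 mg vg.
have cov_g i : covariance P0 g (model_lr (X i)) =
    (gamma (X i) - gamma x0)%:E.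
  by apply: covariance_estimator_model_lr => //; exact: cg.
have cov_lr i j : covariance P0 (model_lr (X i)) (model_lr (X j)) =
    (lr_kernel (X i) (X j) - 1)%:E by exact: covariance_model_lr.
have lr2 i : model_lr (X i) \in Lfun P0 2%:E by exact: Lfun2_gauss_lr.
apply: le_trans (variance_ge_lincomb a g2 lr2 cov_g cov_lr).
by rewrite lee_fin; exact: le_centred_quadratic.
Qed.

End barankin.

(** * Bound along an affine subspace *)

Definition ord_cons {T : Type} {n : nat} (x : T) (f : 'I_n -> T) (i : 'I_n.+1) :
  T := oapp f x (unlift ord0 i).

Lemma ord_cons0 (T : Type) (n : nat) (x : T) (f : 'I_n -> T) :
  ord_cons x f ord0 = x.
Proof. by rewrite /ord_cons unlift_none. Qed.

Lemma ord_consS (T : Type) (n : nat) (x : T) (f : 'I_n -> T) (i : 'I_n) :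
  ord_cons x f (lift ord0 i) = f i.
Proof. by rewrite /ord_cons liftK. Qed.

Lemma sum_ord_cons_increments (R : pzRingType) (n : nat) (alpha : R)
    (a : 'I_n -> R) (f : 'I_n.+1 -> R) :
  \sum_i ord_cons (alpha - \sum_j a j) a i * f i =
  alpha * f ord0 + \sum_i a i * (f (lift ord0 i) - f ord0).
Proof.
rewrite big_ord_recl ord_cons0 mulrBl -addrA; congr (_ + _).
rewrite mulr_suml -sumrN -big_split /=; apply: eq_bigr => i _.
by rewrite ord_consS mulrBr addrC.
Qed.

Lemma quadratic_ord_cons_increments (R : comPzRingType) (n : nat) (alpha e : R)
    (a : 'I_n -> R) (K : 'I_n.+1 -> 'I_n.+1 -> R) :
  (forall i, K i ord0 = e) -> (forall j, K ord0 j = e) ->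
  let w := ord_cons (alpha - \sum_j a j) a in
  \sum_i \sum_j w i * w j * K i j =
  alpha ^+ 2 * e +
  \sum_i \sum_j a i * a j * (K (lift ord0 i) (lift ord0 j) - e).
Proof.
move=> Kl Kr w.
have rowK i : \sum_j w i * w j * K i j =
    w i * (alpha * e + \sum_j a j * (K i (lift ord0 j) - e)).
  under eq_bigr do rewrite -mulrA.
  by rewrite -mulr_sumr sum_ord_cons_increments Kl.
under eq_bigr do rewrite rowK.
rewrite sum_ord_cons_increments; congr (_ + _).
  by rewrite big1 ?addr0 ?mulrA// => j _; rewrite Kr subrr mulr0.
apply: eq_bigr => i _; rewrite [X in _ - (_ + X)]big1 => [|j _].
  by rewrite addr0 addrC addKr mulr_sumr; under eq_bigr do rewrite mulrA.
by rewrite Kr subrr mulr0.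
Qed.

Lemma cvg_expR_quotient (R : realType) (w : R) :
  (expR (t ^+ 2 * w) - 1) / t ^+ 2 @[t --> (0 : R)^'] --> w.
Proof.
have cvg_exp : h^-1 * (expR (h * w) - 1) @[h --> (0 : R)^'] --> w.
  have [ex_dexp dexp] : is_derive (0 : R) 1 (fun h => expR (h * w)) w.
    apply: is_derive_eq.
    by rewrite mul0r expR0 mul1r scaler0 add0r -[LHS]/(w * 1) mulr1.
  rewrite -[X in _ --> X]dexp; apply: cvg_trans ex_dexp; apply: near_eq_cvg.
  by apply: nearW => h /=; rewrite mul0r expR0 addr0 -[h%:A]/(h * 1) mulr1.
have sqr0 : t ^+ 2 @[t --> (0 : R)^'] --> (0 : R)^'.
  move=> B /= B0.
  have := @exprn_continuous R 2 0.
  rewrite /continuous_at expr0n /= => /(_ _ B0).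
  apply: (@filterS _ (nbhs (0 : R))) => t sqrB t0; apply: sqrB.
  by rewrite sqrf_eq0.
rewrite (_ : (fun t => _ / _) =
    (fun h => h^-1 * (expR (h * w) - 1)) \o (fun t => t ^+ 2)).
  exact: cvg_comp cvg_exp.
by apply/funext => t /=; rewrite mulrC.
Qed.

Section affine_directions.
Context (R : realType) (M N S n : nat) (H : 'M[R]_(M, N)) (sigma : R).
Context (k : 'I_N) (c : 'cV[R]_N -> R) (x0 xt : 'cV[R]_N) (D : 'M[R]_(N, n)).
Hypothesis sigma_neq0 : sigma != 0.
Hypothesis sparse_x0 : sparse_set S x0.
Hypothesis sparse_affine : forall v : 'cV[R]_n, sparse_set S (D *m v + xt).

Local Notation A := (H *m D).
Local Notation u := (H *m (xt - x0)).
Local Notation gram := (A^T *m A).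
Local Notation gamma := (prescribed_mean k c).

Hypothesis ortho : A^T *m u = 0.

Local Notation kernel_xt := (expR (sqnorm u / sigma ^+ 2)).

Lemma lr_kernel_affine (v w : 'cV[R]_n) :
  lr_kernel H sigma x0 (D *m v + xt) (D *m w + xt) =
  kernel_xt * expR (dot v (gram *m w) / sigma ^+ 2).
Proof.
have Hx y : H *m (D *m y + xt - x0) = A *m y + u.
  by rewrite -addrA mulmxDr mulmxA.
have Au y : dot (A *m y) u = 0 by rewrite dot_mulmxl ortho dot0r.
rewrite /lr_kernel !Hx dotDl !dotDr Au (dotC u) Au -sqnormE dot_mulmxl.
by rewrite addr0 add0r (addrC (dot _ _)) mulrDl expRD -(mulmxA A^T).
Qed.

Local Notation increment_bound alpha a t :=
  (2 * (alpha * gamma xt +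
     \sum_i a i 0 * (t^-1 *: (gamma (t *: col i D + xt) - gamma xt)))
   - kernel_xt * (alpha ^+ 2 + \sum_i \sum_j a i 0 * a j 0 *
       ((expR (t ^+ 2 * (gram i j / sigma ^+ 2)) - 1) / t ^+ 2))
   - gamma x0 ^+ 2).

Lemma barankin_bound_increments (alpha : R) (a : 'cV[R]_n) (t : R) : t != 0 ->
  ((increment_bound alpha a t)%:E <= min_var S H sigma k c x0)%E.
Proof.
move=> t0; pose y := ord_cons 0 (fun i => t *: delta_mx i 0 : 'cV[R]_n).
pose slope i := a i 0 / t.
pose w := ord_cons (alpha - \sum_i slope i) slope.
pose K i j := lr_kernel H sigma x0 (D *m y i + xt) (D *m y j + xt).
have y0 : D *m y ord0 + xt = xt by rewrite /y ord_cons0 mulmx0 add0r.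
have yS i : D *m y (lift ord0 i) + xt = t *: col i D + xt.
  by rewrite /y ord_consS -scalemxAr -colE.
have K_i0 i : K i ord0 = kernel_xt.
  rewrite /K lr_kernel_affine /y ord_cons0 mulmx0 dot0r.
  by rewrite mul0r expR0 mulr1.
have K_0j j : K ord0 j = kernel_xt.
  rewrite /K lr_kernel_affine /y ord_cons0 dotC dot0r.
  by rewrite mul0r expR0 mulr1.
have K_ij i j : K (lift ord0 i) (lift ord0 j) =
    kernel_xt * expR (t ^+ 2 * (gram i j / sigma ^+ 2)).
  rewrite /K lr_kernel_affine /y !ord_consS -scalemxAr dotZl dotZr dot_delta.
  by rewrite mulrA -expr2 mulrA.
have := @barankin_bound _ _ _ S H _ k c _ sigma_neq0 sparse_x0 _
  (fun i => D *m y i + xt) w (fun i => sparse_affine (y i)).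
congr (_%:E <= _)%E; congr (2 * _ - _ - _).
  rewrite sum_ord_cons_increments y0; congr (_ + _); apply: eq_bigr => i _.
  by rewrite yS mulrA.
rewrite (quadratic_ord_cons_increments _ _ K_i0 K_0j).
rewrite mulrDr mulr_sumr [kernel_xt * _]mulrC; congr (_ + _).
apply: eq_bigr => i _; rewrite mulr_sumr; apply: eq_bigr => j _.
by rewrite K_ij /slope; field.
Qed.

Variable b : 'cV[R]_n.
Hypothesis is_derive_gamma : forall i, is_derive xt (col i D) gamma (b i 0).

Lemma min_var_ge_gradient (alpha : R) (a : 'cV[R]_n) :
  ((2 * (alpha * gamma xt + dot a b)
    - kernel_xt * (alpha ^+ 2 + dot a (gram *m a) / sigma ^+ 2)
    - gamma x0 ^+ 2)%:E <= min_var S H sigma k c x0)%E.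
Proof.
have cvg_gradient :
    \sum_i a i 0 * (t^-1 *: (gamma (t *: col i D + xt) - gamma xt))
    @[t --> (0 : R)^'] --> dot a b.
  rewrite dotE; apply: cvg_big => [|i _]; first exact: add_continuous.
  have [dgamma <-] := is_derive_gamma i.
  by apply: cvgM; [exact: cvg_cst|exact: dgamma].
have cvg_gram : \sum_i \sum_j a i 0 * a j 0 *
      ((expR (t ^+ 2 * (gram i j / sigma ^+ 2)) - 1) / t ^+ 2)
    @[t --> (0 : R)^'] --> dot a (gram *m a) / sigma ^+ 2.
  rewrite dot_mulmxE mulr_suml.
  apply: cvg_big => [|i _]; first exact: add_continuous.
  rewrite mulr_suml; apply: cvg_big => [|j _]; first exact: add_continuous.
  rewrite -[X in _ --> X]mulrA.
  by apply: cvgM; [exact: cvg_cst|exact: cvg_expR_quotient].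
have := @barankin_bound_increments alpha a.
case: min_var => [v| |] bound; last 2 first.
- by rewrite leey.
- by have := bound 1 (oner_neq0 _); rewrite leeNy_eq.
rewrite lee_fin.
apply: (@cvgr_to_le _ (0 : R)^' _ _ (fun t => increment_bound alpha a t)).
  apply: cvgB; last exact: cvg_cst.
  by apply: cvgB; (apply: cvgM; first exact: cvg_cst);
    (apply: cvgD; first exact: cvg_cst).
near=> t; rewrite -lee_fin; apply: bound.
by near: t; exact: nbhs_dnbhs_neq.
Unshelve. all: by end_near. Qed.

Lemma min_var_ge_gram : gram \in unitmx ->
  ((expR (- sqnorm u / sigma ^+ 2) *
    (sigma ^+ 2 * dot b (invmx gram *m b) + gamma xt ^+ 2) - gamma x0 ^+ 2)%:E
   <= min_var S H sigma k c x0)%E.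
Proof.
move=> ugram; set q := dot b _; set e := expR (- _ / _).
have Ee : kernel_xt * e = 1 by rewrite /e mulNr expRxMexpNx_1.
(* These coefficients maximize the bound of [min_var_ge_gradient]. *)
apply: le_trans (min_var_ge_gradient (e * gamma xt)
  ((e * sigma ^+ 2) *: (invmx gram *m b))).
rewrite lee_fin -scalemxAr mulKVmx// !dotZl dotZr (dotC _ b) -/q lerB//.
set Q := _ + gamma xt ^+ 2; rewrite [leRHS](_ : _ = e * Q)//.
transitivity (2 * e * Q - kernel_xt * e * e * Q); first by rewrite /Q; field.
by rewrite Ee; ring.
Qed.

End affine_directions.

(** * Sparse vectors *)

Lemma spark_cols_indep (F : fieldType) (M N : nat) (H : 'M[F]_(M, N))
    (K : {set 'I_N}) :
  (#|K| < spark H)%N -> cols_indep H K.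
Proof.
apply: contraLR => nK; rewrite -leqNgt /spark -minEnat.
exact: (@bigmin_le_cond _ nat _ _ K (fun T => ~~ cols_indep H T)).
Qed.

Lemma sparse_set_supp (R : pzRingType) (N S : nat) (K : {set 'I_N})
    (x : 'cV[R]_N) :
  (#|K| <= S)%N -> supp x \subset K -> sparse_set S x.
Proof.
move=> KS xK; apply: leq_trans KS; apply: subset_leq_card.
apply/fintype.subsetP => i; rewrite inE /= => xi.
by apply: (fintype.subsetP xK); rewrite inE.
Qed.

Lemma suppD (R : pzRingType) (N : nat) (K : {set 'I_N}) (x y : 'cV[R]_N) :
  supp x \subset K -> supp y \subset K -> supp (x + y) \subset K.
Proof.
move=> /fintype.subsetP xK /fintype.subsetP yK; apply/fintype.subsetP => i.
rewrite inE mxE; apply: contraR => iK.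
have /eqP -> : x i 0 == 0 by apply: contraR iK => xi; apply: xK; rewrite inE.
have /eqP -> : y i 0 == 0 by apply: contraR iK => yi; apply: yK; rewrite inE.
by rewrite addr0.
Qed.

Lemma mulmx_colsK (R : pzRingType) (L M N : nat) (B : 'M[R]_(L, M))
    (H : 'M[R]_(M, N)) (K : {set 'I_N}) :
  B *m colsK H K = colsK (B *m H) K.
Proof. by rewrite /colsK -mulmx_colsub. Qed.

Lemma col_colsK1 (R : pzRingType) (N : nat) (K : {set 'I_N}) (i : 'I_#|K|) :
  col i (colsK 1%:M K) = delta_mx (enum_val i) 0 :> 'cV[R]_N.
Proof. by apply/colP => j; rewrite !mxE andbT. Qed.

Lemma supp_mul_colsK1 (R : pzRingType) (N : nat) (K : {set 'I_N})
    (v : 'cV[R]_#|K|) :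
  supp (colsK 1%:M K *m v) \subset K.
Proof.
apply/fintype.subsetP => j; rewrite inE; apply: contraR => jK.
rewrite mxE big1// => i _; rewrite !mxE.
by case: eqP jK => [->|]; rewrite ?enum_valP// mul0r.
Qed.

Lemma is_derive_entry (R : realFieldType) (m n : nat) (x v : 'M[R]_(m, n))
    (i : 'I_m) (j : 'I_n) :
  is_derive x v (fun y : 'M[R]_(m, n) => y i j) (v i j).
Proof.
have did := @derivable_id _ _ x v; split; first exact: (derivable_mxP id x v).1.
have := derive_mx did; rewrite derive_id => /matrixP/(_ i j).
by rewrite mxE => <-.
Qed.

Lemma is_derive_prescribed_mean (R : realType) (N : nat) (k : 'I_N)
    (c : 'cV[R]_N -> R) (x v : 'cV[R]_N) : derivable c x v ->
  is_derive x v (prescribed_mean k c) ('D_v c x + v k 0).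
Proof.
move=> /derivableP dc; rewrite -[prescribed_mean k c]/(c + (fun y => y k 0)).
have dk := is_derive_entry x v k 0; exact: is_deriveD.
Qed.

Theorem theorem8 (R : realType) (M N S : nat) (H : 'M[R]_(M, N)) (sigma : R)
  (k : 'I_N) (x0 : 'cV[R]_N) (K : {set 'I_N}) (xt : 'cV[R]_N)
  (c : 'cV[R]_N -> R) :
  (1 <= S <= N)%N ->
  (S < spark H)%N ->
  0 < sigma ->
  sparse_set S x0 ->
  (#|K| <= S)%N ->
  let HK := colsK H K in
  let P := HK *m mp_pinv HK in
  supp xt \subset K ->
  H *m xt = P *m H *m x0 ->
  (forall ki, ki \in K -> derivable c xt (delta_mx ki 0 : 'cV[R]_N)) ->
  let gamma := fun x : 'cV[R]_N => c x + x k 0 in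
  let b : 'cV[R]_#|K| :=
    \col_i ((k == enum_val i)%:R + 'D_(delta_mx (enum_val i) 0) c xt) in
  ((expR (- (sqnorm ((1%:M - P) *m H *m x0)) / sigma ^+ 2)
      * (sigma ^+ 2 * (b^T *m invmx (HK^T *m HK) *m b) 0 0 + gamma xt ^+ 2)
    - gamma x0 ^+ 2)%:E <= min_var S H sigma k c x0)%E.
Proof.
move=> _ SH sigma0 sx0 KS HK P xtK Hxt dc; cbv beta zeta.
set b : 'cV[R]_#|K| := \col_i _.
have /eqP rankHK : cols_indep H K.
  by apply: spark_cols_indep; exact: leq_ltn_trans SH.
pose D : 'M[R]_(N, #|K|) := colsK 1%:M K.
have HD : H *m D = HK by rewrite mulmx_colsK mulmx1.
have residual : H *m (xt - x0) = - ((1%:M - P) *m H *m x0).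
  by rewrite mulmxBr Hxt mulmxBl mul1mx mulmxBl opprB.
have ortho : (H *m D)^T *m (H *m (xt - x0)) = 0.
  rewrite HD residual mulmxN -mulmxA mulmxA trmx_mul_pinv_residual.
    by rewrite mul0mx oppr0.
  exact: mp_pinvP.
have sparse_affine (v : 'cV[R]_#|K|) : sparse_set S (D *m v + xt).
  by apply: sparse_set_supp KS _; apply: suppD => //; exact: supp_mul_colsK1.
have dgamma i : is_derive xt (col i D) (prescribed_mean k c) (b i 0).
  rewrite col_colsK1 mxE addrC.
  have := is_derive_prescribed_mean k (dc _ (enum_valP i)).
  by rewrite mxE eqxx andbT.
have := min_var_ge_gram (lt0r_neq0 sigma0) sx0 sparse_affine ortho dgamma.
rewrite HD residual sqnormN /dot mulmxA; apply; exact: gram_unitmx.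
Qed.
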